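(* Let $A\geq a\geq 1$ and $r\geq 1$ be integers. For $n\geq 0$ let $\sigma mes_{r,A,a}(n)=\sum_{\pi\in\overline{\mathcal{P}}(n)}mes_{r,A,a}(\pi)$. Then \[ \sum_{n=0}^\infty\sigma mes_{r,A,a}(n)q^n =\frac{(-q;q)_{\infty}}{(q;q)_{\infty}}\bigg[a+A\sum_{k=1}^{\infty}\frac{2^kq^{r[A\binom{k}{2}+ka]}}{(-q^a;q^A)_k}\bigg]. \]
   Context: An overpartition is a partition (finite non-increasing sequence of positive integers) in which the first occurrence of each part value may be overlined; $\overline{\mathcal{P}}(n)$ denotes the set of overpartitions of $n$ (the sum of parts is $n$). A part is of size $t$ if it equals $t$ or $\overline{t}$. $(a;q)_\infty=\prod_{i\geq0}(1-aq^i)$ and $(a;q)_n=(a;q)_\infty/(aq^n;q)_\infty$; $|q|<1$. For $r\geq1$, $mes_{r,A,a}(\pi)$ is the smallest positive integer $\equiv a\pmod A$ such that there are fewer than $r$ parts of size $mes_{r,A,a}(\pi)$ in $\pi$. *)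

(* Defs.v *)
From HB Require Import structures.
From mathcomp Require Import all_boot all_order all_algebra complex.
From mathcomp Require Import all_classical all_reals all_analysis.

Set Implicit Arguments.
Unset Strict Implicit.
Unset Printing Implicit Defensive.

Import Order.TTheory GRing.Theory Num.Theory numFieldNormedType.Exports.

Local Open Scope classical_set_scope.
Local Open Scope ring_scope.

(* A part is a pair (size, overlined?). *)
Definition part : Type := (nat * bool)%type.
Definition part_sizes (pi : seq part) : seq nat := [seq p.1 | p <- pi].

(* The [pairwise] clause allows only the first occurrence of each size to be
   overlined: an overlined part is preceded by no part of the same size. *)
Definition is_overpartition (pi : seq part) : bool :=
  [&& all (fun t => (0 < t)%N) (part_sizes pi),
      sorted geq (part_sizes pi)
    & pairwise (fun p p' : part => p'.2 ==> (p.1 != p'.1)) pi].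

Definition overpartitions (n : nat) : set (seq part) :=
  [set pi | is_overpartition pi /\ sumn (part_sizes pi) = n].

Definition num_parts (t : nat) (pi : seq part) : nat :=
  count_mem t (part_sizes pi).

Definition mes_candidate (r A a : nat) (pi : seq part) (m : nat) : bool :=
  [&& (0 < m)%N, m == a %[mod A] & (num_parts m pi < r)%N].

(* The default value 0 is irrelevant when 0 < A and 0 < r: see [mesP]. *)
Definition mes (r A a : nat) (pi : seq part) : nat :=
  if pselect (exists m, mes_candidate r A a pi m) is left ex
  then ex_minn ex else 0%N.

(* A genuine finite sum: see [finite_overpartitions]. *)
Definition sigma_mes (r A a n : nat) : nat :=
  (\big[addn/0%N]_(pi \in overpartitions n) mes r A a pi)%N.

Definition qpoch_inf (K : numFieldType) (x q : K) : K :=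
  limn (fun n => \prod_(0 <= i < n) (1 - x * q ^+ i)).

Definition qpoch (K : numFieldType) (x q : K) (n : nat) : K :=
  qpoch_inf x q / qpoch_inf (x * q ^+ n) q.

(* R[i] packed as a numFieldType, so as to get the topology induced by the
   modulus. *)
Definition complexes (R : realType) : numFieldType := R[i].

Lemma mes_exists r A a pi : (0 < A)%N -> (0 < r)%N ->
  exists m, mes_candidate r A a pi m.
Proof.
move=> A0 r0; pose N := sumn (part_sizes pi).
exists (a + N.+1 * A)%N; rewrite /mes_candidate; apply/and3P; split.
- by rewrite addn_gt0 muln_gt0 /= A0 orbT.
- by rewrite addnC modnMDl.
- apply: leq_trans r0; rewrite ltnS leqn0; apply/eqP/count_memPn/negP => Hin.
  have : (a + N.+1 * A <= N)%N.
    rewrite {2}/N; elim: (part_sizes pi) Hin => //= t s IH.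
    rewrite inE => /orP[/eqP <-|/IH h]; first exact: leq_addr.
    by apply: leq_trans h _; exact: leq_addl.
  rewrite leqNgt => /negP; apply; apply: leq_trans (leq_addl _ _).
  by rewrite leq_pmulr.
Qed.

Lemma mesP r A a pi : (0 < A)%N -> (0 < r)%N ->
  mes_candidate r A a pi (mes r A a pi) /\
  forall m, mes_candidate r A a pi m -> (mes r A a pi <= m)%N.
Proof.
move=> A0 r0; rewrite /mes; case: pselect => [ex|[]]; last exact: mes_exists.
by case: ex_minnP.
Qed.

Lemma finite_overpartitions n : finite_set (overpartitions n).
Proof.
pose f (s : {bseq n of 'I_n.+1 * bool}) : seq part :=
  [seq (val p.1, p.2) | p <- s].
apply: (@sub_finite_set _ _ (f @` [set: {bseq n of 'I_n.+1 * bool}])); last first.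
  by apply: finite_image; exact: finite_finset.
move=> pi [] /and3P[pos _ _] sn.
have szn : (size pi <= n)%N.
  rewrite -sn; elim: pi pos {sn} => //= p pi IH /andP[p0 /IH h].
  by rewrite -add1n leq_add.
have len : forall p, p \in pi -> (p.1 < n.+1)%N.
  rewrite -sn => p; elim: pi {pos szn sn} => //= p' pi IH.
  rewrite inE => /orP[/eqP ->|/IH h]; first by rewrite ltnS leq_addr.
  by apply: leq_trans h _; rewrite ltnS leq_addl.
pose g (p : part) : 'I_n.+1 * bool := (inord p.1, p.2).
have szg : (size [seq g p | p <- pi] <= n)%N by rewrite size_map.
exists (Bseq szg) => //; rewrite /f /= -map_comp -[RHS]map_id.
by apply/eq_in_map => -[t b] /len /= tn; rewrite /g /= inordK.
Qed.

(* Main.v *)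
Require Import Defs.
From HB Require Import structures.
From mathcomp Require Import all_boot all_order all_algebra complex.
From mathcomp Require Import all_classical all_reals all_analysis.
From mathcomp Require Import zify ring lra.

(** Sizes congruent to [a] modulo [A] are [t_j = a + j * A], so
    [mes pi = a + A * #{k >= 1 | t_0, ..., t_(k-1) all occur at least r times}].
    In the generating function of overpartitions a size [t] contributes
    [(1 + q^t) / (1 - q^t)], and [2 q^(r t) / (1 - q^t)] when it must occur at
    least [r] times; the quotients [2 q^(r t_j) / (1 + q^t_j)] multiply up to
    the [k]-th term of the series.

    Analytically, bounding part sizes by [N] and multiplicities by [M] turns the
    generating function into a finite sum which factors exactly.  Letting [M]
    tend to infinity with [N = a + L * A] gives the finite product times the
    partial sum of the right-hand series.  For [M, N >= L] this truncation
    differs from the [L]-th partial sum of the left-hand series by at most the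
    tail of the same series at [|q|], whose convergence follows from the same
    factorization for real arguments. *)

Set Implicit Arguments.
Unset Strict Implicit.
Unset Printing Implicit Defensive.

Import Order.TTheory GRing.Theory Num.Theory numFieldNormedType.Exports.
Import ComplexField.Normc.

Local Open Scope classical_set_scope.
Local Open Scope ring_scope.

(** * Overpartitions with bounded parts and multiplicities *)

(** Order and overlining are merged into one pairwise relation, so that [pairwise_cat] handles
    concatenations of blocks. *)
Definition part_rel (p p' : part) : bool :=
  (p'.1 <= p.1)%N && (p'.2 ==> (p.1 != p'.1)).

Lemma is_overpartitionE pi : is_overpartition pi =
  all (fun p : part => (0 < p.1)%N) pi && pairwise part_rel pi.
Proof.
rewrite /is_overpartition /part_sizes all_map sorted_pairwise; last first.
  by move=> x y z /= yx xz; apply: leq_trans xz yx.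
rewrite pairwise_map; congr (_ && _); elim: pi => //= p pi <-.
rewrite (_ : all (part_rel p) pi = all (fun p' : part => p'.1 <= p.1)%N pi &&
  all (fun p' : part => p'.2 ==> (p.1 != p'.1)) pi); last by rewrite -all_predI.
by rewrite /relpre/=; do 3?case: all; do 2?case: pairwise.
Qed.

(* The parts of size [t]: [c.1] of them, the first one overlined if [c.2]. *)
Definition block (t : nat) (c : nat * bool) : seq part :=
  if c.1 is m.+1 then (t, c.2) :: nseq m (t, false) else [::].

(** The pair [(0, true)] is left out: it would give the same empty block as [(0, false)] and count
    it twice. *)
Definition multiplicities (M : nat) : seq (nat * bool) :=
  (0%N, false) :: [seq (m, b) | m <- iota 1 M, b <- [:: false; true]].

Fixpoint bounded_overpartitions (M N : nat) : seq (seq part) :=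
  if N is N'.+1 then
    [seq block N c ++ pi | c <- multiplicities M,
                           pi <- bounded_overpartitions M N']
  else [:: [::]].

Lemma bounded_overpartitionsS M N : bounded_overpartitions M N.+1 =
  [seq block N.+1 c ++ pi | c <- multiplicities M, pi <- bounded_overpartitions M N].
Proof. by []. Qed.

Lemma mem_multiplicities M c :
  (c \in multiplicities M) = (c.1 <= M)%N && (c.2 ==> (0 < c.1)%N).
Proof.
rewrite in_cons; case: c => m b; apply/orP/andP => [[/eqP[-> ->]//|]|[mM]].
  move=> /(@allpairsP _ _ _ pair)[[m' b'] /= [mi _ [-> ->]]]; move: mi; rewrite mem_iota.
  by case: b' => /=; lia.
rewrite /= in mM; case: m mM => [|m] mM; first by case: b => // _; left.
move=> _; right; apply/(@allpairsP _ _ _ pair); exists (m.+1, b).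
rewrite mem_iota; split=> //=.
by rewrite !inE; case: b.
Qed.

Lemma uniq_multiplicities M : uniq (multiplicities M).
Proof.
rewrite cons_uniq; apply/andP; split.
  apply/negP => /(@allpairsP _ _ _ pair)[[m b] /= [mi _ [m0 _]]].
  by rewrite mem_iota -m0 in mi.
by apply: (@allpairs_uniq _ _ _ pair) => [||[? ?] [? ?]]; rewrite ?iota_uniq.
Qed.

Lemma block_sizes t c : part_sizes (block t c) = nseq c.1 t.
Proof. by case: c => -[|m] b //=; rewrite /part_sizes map_nseq. Qed.

Lemma block_inj t : {in [pred c | c.2 ==> (0 < c.1)%N] &, injective (block t)}.
Proof.
move=> [m b] [m' b']; rewrite !inE /= => h h' E.
have mm : m = m'.
  by have := congr1 (fun s => size (part_sizes s)) E; rewrite !block_sizes !size_nseq.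
by subst m'; case: m h h' E => [|m] /=; case: b; case: b'.
Qed.

Lemma block_all t c (P : pred nat) : P t -> all (fun p : part => P p.1) (block t c).
Proof.
by move=> Pt; rewrite -(all_map fst P) -/(part_sizes _) block_sizes all_nseq Pt orbT.
Qed.

Lemma block_pairwise t c : pairwise part_rel (block t c).
Proof.
case: c => -[|m] b //=; apply/andP; split.
  by rewrite all_nseq /part_rel /= leqnn orbT.
by elim: m => //= m ->; rewrite all_nseq /part_rel /= leqnn orbT.
Qed.

(** Induction on the list: a head of size [t] is absorbed into the block of the tail and keeps its
    own overline. *)
Lemma overpartition_block t pi : is_overpartition pi ->
    all (fun p : part => p.1 <= t)%N pi ->
  exists c pi', [/\ pi = block t c ++ pi', c.2 ==> (0 < c.1)%N,
    is_overpartition pi' & all (fun p : part => p.1 < t)%N pi'].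
Proof.
elim: pi => [|p pi IH] op le; first by exists (0%N, false), [::].
have [pt|pt] := ltnP p.1 t.
  exists (0%N, false), (p :: pi); split => //=; rewrite pt /=.
  move: op; rewrite is_overpartitionE /= => /andP[_ /andP[h _]].
  by apply: sub_all h => p' /andP[h _]; apply: leq_ltn_trans h pt.
have {pt}pt : p.1 = t by move: le => /= /andP[]; lia.
move: op; rewrite is_overpartitionE /= => /andP[/andP[p0 pos] /andP[pr pw]].
case: IH => [||[m b] [pi' [E mb op' lt]]].
- by rewrite is_overpartitionE pos.
- by case/andP: le.
(* An overline in the block of the tail would sit on a part preceded by [p], which has the same
   size. *)
have {mb}b0 : b = false.
  case: b mb E => //=; case: m => //= m _ E; move: pr; rewrite E /= /part_rel /=.
  by rewrite pt eqxx andbF.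
subst b; exists (m.+1, p.2), pi'; split => //=; last by rewrite implybT.
have pE : p = (t, p.2) by rewrite -pt -surjective_pairing.
by rewrite E [in LHS]pE; case: m {E}.
Qed.

Lemma num_parts_block t s c pi :
  num_parts s (block t c ++ pi) = ((t == s) * c.1 + num_parts s pi)%N.
Proof.
by rewrite /num_parts /part_sizes map_cat count_cat -/(part_sizes _) block_sizes
  count_nseq /=.
Qed.

Lemma sumn_block t c pi :
  sumn (part_sizes (block t c ++ pi)) = (t * c.1 + sumn (part_sizes pi))%N.
Proof.
by rewrite /part_sizes map_cat sumn_cat -/(part_sizes _) block_sizes sumn_nseq.
Qed.

Lemma num_parts_gt pi t : all (fun p : part => p.1 < t)%N pi -> num_parts t pi = 0%N.
Proof.
move=> /allP h; apply/count_memPn/negP => /mapP[p /h lt E].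
by rewrite E ltnn in lt.
Qed.

Lemma bounded_overpartitionsP M N pi :
  reflect [/\ is_overpartition pi, all (fun p : part => p.1 <= N)%N pi
             & forall t, num_parts t pi <= M]%N
          (pi \in bounded_overpartitions M N).
Proof.
apply/(iffP idP).
  elim: N pi => [|N IH] pi; first by rewrite inE => /eqP ->.
  case/allpairsP => -[c pi'] /= [+ /IH[op le mM] ->].
  rewrite mem_multiplicities => /andP[cM c0]; split.
  - move: op; rewrite !is_overpartitionE all_cat pairwise_cat block_pairwise.
    move=> /andP[-> ->]; rewrite (block_all c (P := fun n => 0 < n)%N) // !andbT /=.
    apply/allrelP => p p' pb pp'.
    have /allP/(_ _ pb)/eqP pN := block_all c (P := pred1 N.+1) (eqxx N.+1).
    move/allP: le => /(_ _ pp') le; rewrite /part_rel pN leqW //=.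
    by apply/implyP => _; rewrite gtn_eqF.
  - rewrite all_cat (block_all c (P := fun n => n <= N.+1)%N) //=.
    by apply: sub_all le => p; apply: leqW.
  - move=> t; rewrite num_parts_block; case: eqP => [<-|_]; last by rewrite mul0n add0n.
    by rewrite num_parts_gt ?addn0 ?mul1n.
elim: N pi => [|N IH] pi [op le mM].
  case: pi op le mM => // p pi; rewrite is_overpartitionE /=.
  by case/andP => /andP[]; lia.
have [c [pi' [E c0 op' lt]]] := overpartition_block op le.
rewrite E; apply/allpairsP; exists (c, pi'); split => //=.
  rewrite mem_multiplicities c0 andbT.
  by apply: leq_trans (mM N.+1); rewrite E num_parts_block eqxx mul1n leq_addr.
apply: IH; split => // t; apply: leq_trans (mM t).
by rewrite E num_parts_block leq_addl.
Qed.

(** The decomposition is unique: keeping the sizes below [N.+1] recovers the second component, and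
    the block is what remains. *)
Lemma uniq_bounded_overpartitions M N : uniq (bounded_overpartitions M N).
Proof.
elim: N => // N IH; rewrite bounded_overpartitionsS.
apply: allpairs_uniq => //; first exact: uniq_multiplicities.
have pP := @allpairsP _ _ _ pair (multiplicities M) (bounded_overpartitions M N).
move=> [c pi] [c' pi'] /pP[[x y] /= [cM piE [-> ->]]] {c pi}.
move=> /pP[[x' y'] /= [cM' piE' [-> ->]]] /= {c' pi'}Exy.
move: cM cM'; rewrite !mem_multiplicities => /andP[_ c0] /andP[_ c0'].
have lt pi : pi \in bounded_overpartitions M N -> all (fun p : part => p.1 < N.+1)%N pi.
  by case/bounded_overpartitionsP.
have fb c : [seq p <- block N.+1 c | (p.1 < N.+1)%N] = [::].
  apply/eqP; rewrite -size_eq0 size_filter -leqn0 leqNgt -has_count.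
  apply/hasP => -[p /(allP (block_all c (P := pred1 N.+1) (eqxx N.+1)))/eqP ->].
  by rewrite ltnn.
have yy : y = y'.
  have := congr1 (seq.filter (fun p : part => p.1 < N.+1)%N) Exy.
  by rewrite !filter_cat !fb /= !(all_filterP (lt _ _)).
move/eqP: (Exy); rewrite yy eqseq_cat => [/andP[/eqP /block_inj -> //]|].
(* [eqseq_cat] also asks for blocks of equal length; comparing total sizes gives this. *)
have := congr1 (fun s => sumn (part_sizes s)) Exy; rewrite !sumn_block yy => /addIn.
move=> /eqP; rewrite eqn_mul2l /= => /eqP xx.
by rewrite -!(size_map fst) -!/(part_sizes _) !block_sizes !size_nseq xx.
Qed.

(** * Truncated generating functions *)

Lemma bounded_num_parts_gt M N pi t : pi \in bounded_overpartitions M N ->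
  (N < t)%N -> num_parts t pi = 0%N.
Proof.
move=> /bounded_overpartitionsP[_ le _] Nt; apply: num_parts_gt.
by apply: sub_all le => p pN; apply: leq_ltn_trans pN Nt.
Qed.

(** Multiplicities at distinct sizes are chosen independently, so distributivity applies one size at
    a time. *)
Lemma sum_bounded_overpartitions (K : comNzRingType) M N (phi : nat -> nat -> K) :
  \sum_(pi <- bounded_overpartitions M N)
    \prod_(1 <= t < N.+1) phi t (num_parts t pi) =
  \prod_(1 <= t < N.+1) \sum_(c <- multiplicities M) phi t c.1.
Proof.
elim: N => [|N IH]; first by rewrite big_seq1 !big_nil.
rewrite bounded_overpartitionsS big_allpairs_dep [RHS]big_nat_recr //= -IH.
rewrite big_distrlr /= [RHS]exchange_big /=.
apply: eq_bigr => c _; rewrite !big_seq; apply: eq_bigr => pi piE.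
rewrite big_nat_recr //= num_parts_block eqxx mul1n.
rewrite (bounded_num_parts_gt piE) // addn0; congr (_ * _).
apply: eq_big_nat => t /andP[_ tN]; by rewrite num_parts_block gtn_eqF.
Qed.

Lemma bounded_weight (K : comNzRingType) M N pi (y : K) :
  pi \in bounded_overpartitions M N ->
  y ^+ sumn (part_sizes pi) = \prod_(1 <= t < N.+1) y ^+ (t * num_parts t pi).
Proof.
elim: N pi => [|N IH] pi; first by rewrite inE => /eqP ->; rewrite big_nil.
rewrite bounded_overpartitionsS => /allpairsP[[c pi'] /= [_ piE ->]].
rewrite big_nat_recr //= num_parts_block eqxx mul1n.
rewrite (bounded_num_parts_gt piE) // addn0 sumn_block addnC exprD IH //.
congr (_ * _); apply: eq_big_nat => t /andP[_ tN].
by rewrite num_parts_block gtn_eqF // mul0n add0n.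
Qed.

Definition progression (A a k : nat) : seq nat := [seq (a + j * A)%N | j <- iota 0 k].

Lemma progressionP A a k t :
  reflect (exists2 j, (j < k)%N & t = (a + j * A)%N) (t \in progression A a k).
Proof.
rewrite /progression; apply: (iffP mapP) => -[j jk ->]; exists j => //.
  by rewrite mem_iota in jk.
by rewrite mem_iota.
Qed.

Definition dense_on (r : nat) (s : seq nat) (pi : seq part) : bool :=
  all (fun t => r <= num_parts t pi)%N s.

(** If [mes] is [a + j * A], the first [k] sizes of the progression are all dense exactly when
    [k <= j], so summing these indicators over [k >= 1] gives [j]. *)
Lemma mes_progression r A a L pi : (1 <= a <= A)%N -> (1 <= r)%N ->
    all (fun p : part => p.1 <= a + L * A)%N pi ->
  mes r A a pi =
  (a + A * \sum_(1 <= k < L.+2) dense_on r (progression A a k) pi)%N.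
Proof.
move=> /andP[a0 aA] r0 le.
have A0 : (0 < A)%N by apply: leq_trans a0 aA.
have [/and3P[m0 mA mr] mmin] := mesP a pi A0 r0.
set m := mes r A a pi in m0 mA mr mmin *.
have [j mE] : exists j, m = (a + j * A)%N.
  (* Since [1 <= a <= A], [a] is the least positive member of its class; [a = A] is separate because
     its residue is [0]. *)
  have am : (a <= m)%N.
    rewrite leqNgt; apply/negP => ma; move: mA.
    move: aA; rewrite leq_eqVlt => /orP[/eqP aA|aA].
      by rewrite aA modnn modn_small; lia.
    by rewrite !modn_small; lia.
  exists ((m - a) %/ A)%N; rewrite divnK ?subnKC //.
  by rewrite -eqn_mod_dvd.
(* The size [a + L.+1 * A] exceeds every part, so it is a candidate; this is why the sum may stop at
   [k = L.+1]. *)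
have jL : (j <= L.+1)%N.
  rewrite -(leq_pmul2r A0) -(leq_add2l a) -mE; apply: mmin.
  apply/and3P; split; [lia|by rewrite addnC modnMDl|].
  rewrite num_parts_gt //; apply: sub_all le => p; rewrite mulSn; lia.
have dE k : dense_on r (progression A a k) pi = (k <= j)%N.
  apply/allP/idP => [h|kj t /progressionP[i ik ->]].
    rewrite leqNgt; apply/negP => jk; have := h m.
    by rewrite leqNgt mr => h'; have := h' (introT (progressionP _ _ _ _)
      (ex_intro2 _ _ j jk mE)).
  rewrite leqNgt; apply/negP => lt.
  suff : (m <= a + i * A)%N by rewrite mE leq_add2l leq_pmul2r //; lia.
  apply: mmin; apply/and3P; split => //; first lia.
  by rewrite addnC modnMDl.
rewrite mE mulnC; congr (_ + _ * _)%N.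
under eq_bigr do rewrite dE.
rewrite (@big_cat_nat _ _ _ j.+1) //=.
rewrite [X in (X + _)%N](_ : _ = \sum_(1 <= k < j.+1) 1)%N; last first.
  by apply: eq_big_nat => k /andP[_]; rewrite ltnS => ->.
rewrite sum_nat_const_nat muln1 big_nat big1 ?addn0; first lia.
by move=> k /andP[jk _]; rewrite leqNgt jk.
Qed.

(** This gives the indicator the product shape required by [sum_bounded_overpartitions]. *)
Lemma dense_on_prod (K : comNzRingType) r s N pi :
  {subset s <= index_iota 1 N.+1} ->
  (dense_on r s pi)%:R =
  \prod_(1 <= t < N.+1) ((t \in s) ==> (r <= num_parts t pi)%N)%:R :> K.
Proof.
move=> sN; rewrite (_ : dense_on r s pi =
  all (fun t => (t \in s) ==> (r <= num_parts t pi)%N) (index_iota 1 N.+1)).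
  elim: (index_iota _ _) => [|t l IH]; first by rewrite big_nil.
  by rewrite big_cons -IH -natrM mulnb.
apply/allP/allP => h t; first by move=> _; apply/implyP => /h.
by move=> ts; have := h t (sN _ ts); rewrite ts.
Qed.

Lemma progression_sub A a k N : (0 < a)%N -> (forall j, j < k -> a + j * A <= N)%N ->
  {subset progression A a k <= index_iota 1 N.+1}.
Proof.
move=> a0 h t /progressionP[j jk ->]; rewrite mem_index_iota.
by have := h j jk; lia.
Qed.

Definition trunc_factor (K : comNzRingType) (r M : nat) (s : seq nat) (y : K) t : K :=
  \sum_(c <- multiplicities M) ((t \in s) ==> (r <= c.1)%N)%:R * y ^+ (t * c.1).

Definition trunc_mes_gf (K : comNzRingType) (r A a M N : nat) (y : K) : K :=
  \sum_(pi <- bounded_overpartitions M N)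
    (mes r A a pi)%:R * y ^+ sumn (part_sizes pi).

Lemma trunc_mes_gfE (K : comNzRingType) r A a M L (y : K) :
    (1 <= a <= A)%N -> (1 <= r)%N ->
  trunc_mes_gf r A a M (a + L * A) y =
  a%:R * \prod_(1 <= t < (a + L * A).+1) trunc_factor r M [::] y t +
  A%:R * \sum_(1 <= k < L.+2) \prod_(1 <= t < (a + L * A).+1)
    trunc_factor r M (progression A a k) y t.
Proof.
move=> aA r0; set N := (a + L * A)%N.
have gf s : {subset s <= index_iota 1 N.+1} ->
    \prod_(1 <= t < N.+1) trunc_factor r M s y t =
    \sum_(pi <- bounded_overpartitions M N)
      (dense_on r s pi)%:R * y ^+ sumn (part_sizes pi).
  move=> sN; rewrite -(@sum_bounded_overpartitions K M N
    (fun t m => ((t \in s) ==> (r <= m)%N)%:R * y ^+ (t * m))).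
  rewrite !big_seq; apply: eq_bigr => pi piE.
  by rewrite (bounded_weight y piE) (dense_on_prod _ _ _ sN) -big_split.
rewrite gf // [X in _ = _ + _ * X](_ : _ = \sum_(1 <= k < L.+2)
    \sum_(pi <- bounded_overpartitions M N)
      (dense_on r (progression A a k) pi)%:R * y ^+ sumn (part_sizes pi)); last first.
  apply: eq_big_nat => k /andP[_ kL]; apply: gf; apply: progression_sub; first lia.
  by move=> j jk; rewrite leq_add2l leq_mul2r; apply/orP; right; lia.
rewrite exchange_big /= !mulr_sumr -big_split /= /trunc_mes_gf !big_seq.
apply: eq_bigr => pi /bounded_overpartitionsP[_ le _].
rewrite (mes_progression aA r0 le) natrD natrM natr_sum mul1r mulrDl -mulrA.
by rewrite mulr_suml.
Qed.

(** A positive multiplicity counts twice, with its first occurrence overlined or not. *)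
Lemma sum_multiplicities (K : comNzRingType) M (f : nat -> K) :
  \sum_(c <- multiplicities M) f c.1 = f 0%N + 2 * \sum_(1 <= m < M.+1) f m.
Proof.
rewrite big_cons; congr (_ + _); rewrite big_allpairs_dep /index_iota subSS subn0.
rewrite mulr_sumr; apply: eq_bigr => m _; rewrite !big_cons big_nil /= addr0.
by rewrite mulr_natl mulr2n.
Qed.

Lemma leq_sumn (s : seq nat) t : t \in s -> (t <= sumn s)%N.
Proof.
elim: s => //= u s IH; rewrite inE => /orP[/eqP ->|/IH]; first exact: leq_addr.
by move=> h; apply: leq_trans h (leq_addl _ _).
Qed.

Lemma overpartition_bounded n M N pi : overpartitions n pi -> (n <= M)%N -> (n <= N)%N ->
  pi \in bounded_overpartitions M N.
Proof.
move=> [op sn] nM nN; apply/bounded_overpartitionsP; split => //.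
  apply/allP => p pp; apply: leq_trans nN; rewrite -sn leq_sumn //.
  exact: map_f.
move=> t; apply: leq_trans nM; rewrite -sn; apply: leq_trans (count_size _ _) _.
case/and3P: op => + _ _; elim: (part_sizes pi) => //= u s IH /andP[u0 /IH].
by rewrite -add1n; apply: leq_add.
Qed.

Lemma sigma_mesE r A a n M N : (n <= M)%N -> (n <= N)%N ->
  sigma_mes r A a n = (\sum_(pi <- bounded_overpartitions M N
    | sumn (part_sizes pi) == n) mes r A a pi)%N.
Proof.
move=> nM nN; rewrite -big_filter fsbig_seq ?filter_uniq ?uniq_bounded_overpartitions //.
rewrite /sigma_mes; congr (\big[_/_]_(_ \in _) _); apply/seteqP; split => pi /=.
  move=> op; rewrite mem_filter (overpartition_bounded op) // andbT.
  by case: op => _ ->.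
rewrite mem_filter => /andP[/eqP sn /bounded_overpartitionsP[op _ _]].
by split.
Qed.

(** For arbitrary [M] and [N] the list may miss overpartitions of [n]; raising both bounds to at
    least [n] only adds nonnegative terms. *)
Lemma leq_sigma_mes r A a n M N : (\sum_(pi <- bounded_overpartitions M N
    | sumn (part_sizes pi) == n) mes r A a pi <= sigma_mes r A a n)%N.
Proof.
rewrite (sigma_mesE _ _ _ (leq_maxl n M) (leq_maxl n N)).
set BN := bounded_overpartitions (maxn n M) _.
rewrite (@perm_big _ _ _ _ _ [seq pi <- BN | pi \in bounded_overpartitions M N]).
  by rewrite big_filter_cond big_mkcondl leq_sum // => pi _; case: ifP.
apply: uniq_perm; rewrite ?filter_uniq ?uniq_bounded_overpartitions // => pi.
rewrite mem_filter; case: (boolP (pi \in _)) => //= /bounded_overpartitionsP[op le mM].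
apply/esym/bounded_overpartitionsP; split => //.
  by apply: sub_all le => p pN; apply: leq_trans pN (leq_maxr _ _).
by move=> t; apply: leq_trans (mM t) (leq_maxr _ _).
Qed.

Lemma trunc_mes_gf_sum (K : comNzRingType) r A a M N (y : K) :
  exists B0, forall B, (B0 <= B)%N -> trunc_mes_gf r A a M N y =
  \sum_(0 <= n < B) (\sum_(pi <- bounded_overpartitions M N
    | sumn (part_sizes pi) == n) mes r A a pi)%N%:R * y ^+ n.
Proof.
(* A crude strict bound on every weight in the list. *)
exists (\sum_(pi <- bounded_overpartitions M N) sumn (part_sizes pi)).+1 => B hB.
transitivity (\sum_(pi <- bounded_overpartitions M N) \sum_(0 <= n < B)
    if sumn (part_sizes pi) == n then (mes r A a pi)%:R * y ^+ n else 0).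
  rewrite /trunc_mes_gf !big_seq; apply: eq_bigr => pi piE.
  rewrite (bigD1_seq (sumn (part_sizes pi))) /=.
  - by rewrite eqxx big1 ?addr0 // => n; rewrite eq_sym => /negbTE ->.
  - rewrite mem_index_iota /=; apply: leq_trans hB; rewrite ltnS.
    by rewrite (big_rem pi) //= leq_addr.
  - exact: iota_uniq.
rewrite exchange_big /=; apply: eq_bigr => n _; rewrite natr_sum mulr_suml.
by rewrite [RHS]big_mkcond.
Qed.

(** * Complex sequences and infinite products *)

Local Open Scope complex_scope.

Section ComplexSequences.
Variable R : realType.
Implicit Types (u : nat -> complexes R) (l z : complexes R).

(** The norm of [complexes R] is itself complex-valued; the estimates below use its real counterpart
    [normc]. *)
Lemma normcC z : `|z| = (normc z)%:C :> R[i].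
Proof. by []. Qed.

Lemma normc_ge0 z : 0 <= normc z.
Proof. by rewrite -lecR -normcC normr_ge0. Qed.

Lemma normcX z n : normc (z ^+ n) = normc z ^+ n.
Proof. by elim: n => [|n IH]; rewrite ?expr0 ?normc1 // !exprS normcM IH. Qed.

Lemma normc_Re z : `|complex.Re z| <= normc z.
Proof. by rewrite -lecR -normcC normc_ge_Re. Qed.

Lemma normc_Im z : `|complex.Im z| <= normc z.
Proof.
case: z => x y /=; rewrite -sqrtr_sqr ler_wsqrtr // lerDr; exact: sqr_ge0.
Qed.

Lemma ltr_dist_normc (z l : complexes R) (e : R) :
  (`|l - z| < (e%:C : complexes R)) = (`|0 - normc (z - l)| < e).
Proof.
rewrite [in RHS]sub0r [in RHS]normrN [in RHS]ger0_norm ?normc_ge0 //.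
by rewrite distrC; exact: ltcR.
Qed.

Lemma cvg_normcP u l :
  (u @ \oo --> l) <-> ((fun n => normc (u n - l)) @ \oo --> (0 : R)).
Proof.
split => [/cvgrPdist_lt h|/cvgrPdist_lt h]; apply/cvgrPdist_lt => e e0.
  have e0' : 0 < (e%:C : complexes R) by rewrite ltcR.
  by apply: filterS (h _ e0') => n; rewrite ltr_dist_normc.
(* Here [e] is a complex number; being positive, it is real. *)
have [k ek] : exists k : R, e = k%:C by apply/complex_realP; rewrite gtr0_real.
move: e0; rewrite ek ltcR => k0; apply: filterS (h _ k0) => n.
by rewrite ltr_dist_normc.
Qed.

Lemma normc_le_cvg u l (b : nat -> R) :
  (forall n, normc (u n - l) <= b n) -> b @ \oo --> (0 : R) -> u @ \oo --> l.
Proof.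
move=> ub b0; apply/cvg_normcP; apply: (squeeze_cvgr _ (cvg_cst 0) b0).
by apply: nearW => n; rewrite normc_ge0 ub.
Qed.

Lemma cvg_complex u (x y : R) :
  (fun n => complex.Re (u n)) @ \oo --> x -> (fun n => complex.Im (u n)) @ \oo --> y ->
  u @ \oo --> (x +i* y : complexes R).
Proof.
move=> cx cy.
apply: (@normc_le_cvg _ _
  (fun n => `|complex.Re (u n) - x| + `|complex.Im (u n) - y|)); last first.
  rewrite -[0 in X in _ --> X](addr0 0); apply: cvgD.
    by rewrite -(normr0 R) -(subrr x); apply: cvg_norm; apply: cvgB cx (cvg_cst x).
  by rewrite -(normr0 R) -(subrr y); apply: cvg_norm; apply: cvgB cy (cvg_cst y).
move=> n; case: (u n) => v w /=; rewrite -[leRHS]ger0_norm ?addr_ge0 // -sqrtr_sqr.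
rewrite ler_wsqrtr // [leRHS]sqrrD !real_normK ?num_real // [leRHS]addrAC.
by rewrite lerDl mulrn_wge0 // mulr_ge0.
Qed.

(** Real and imaginary parts are dominated by [b], so comparison and absolute convergence over the
    reals apply to each. *)
Lemma normc_series_cvg u (b : nat -> R) :
  (forall n, normc (u n) <= b n) -> cvgn (series b) -> cvgn (series u).
Proof.
move=> ub cb.
have h (f : complexes R -> R) : {morph f : z w / z + w} -> f 0 = 0 ->
    (forall z, `|f z| <= normc z) -> cvgn (fun n => f (series u n)).
  move=> fD f0 fb; rewrite (_ : (fun n => _) = series (f \o u)); last first.
    by apply/funext => n; rewrite /series /= (big_morph f fD f0).
  apply: normed_cvg; apply: series_le_cvg cb => n //=.
    by apply: le_trans (ub n); apply: normc_ge0.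
  exact: le_trans (fb _) (ub n).
have /cvg_ex[x cx] : cvgn (fun n => complex.Re (series u n)).
  by apply: h normc_Re => // -[? ?] [? ?].
have /cvg_ex[y cy] : cvgn (fun n => complex.Im (series u n)).
  by apply: h normc_Im => // -[? ?] [? ?].
by apply: cvgP (cvg_complex cx cy).
Qed.

Lemma cvg_exprC z : normc z < 1 -> (fun n => z ^+ n) @ \oo --> (0 : complexes R).
Proof.
move=> z1; apply: (@normc_le_cvg _ _ (fun n => normc z ^+ n)) => [n|].
  by rewrite subr0 normcX.
by apply: cvg_expr; rewrite ger0_norm ?normc_ge0.
Qed.

End ComplexSequences.

(** * Uniform bounds for real products *)

Section ProductBounds.
Variable R : realType.
Implicit Types c x : R.

(** From [1 + y <= expR y] and the sum of the geometric series. *)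
Lemma prod1D_bounded c x : 0 <= c -> 0 <= x < 1 ->
  exists B, forall n, \prod_(0 <= i < n) (1 + c * x ^+ i) <= B.
Proof.
move=> c0 /andP[x0 x1]; exists (expR (c / (1 - x))) => n.
apply: (@le_trans _ _ (expR (\sum_(0 <= i < n) c * x ^+ i))).
  elim: n => [|n IH]; first by rewrite !big_nil expR0.
  rewrite !big_nat_recr //= expRD ler_pM ?expR_ge1Dx //.
    by apply: prodr_ge0 => i _; rewrite addr_ge0 // mulr_ge0 // exprn_ge0.
  by rewrite addr_ge0 // mulr_ge0 // exprn_ge0.
rewrite ler_expR -mulr_sumr ler_wpM2l // -[leRHS]mul1r ler_pdivlMr ?subr_gt0 //.
have -> : (\sum_(0 <= i < n) x ^+ i) * (1 - x) = 1 - x ^+ n.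
  elim: n => [|n IH]; first by rewrite big_nil expr0; ring.
  by rewrite big_nat_recr //= mulrDl IH exprS; ring.
by rewrite gerBl exprn_ge0.
Qed.

(** For [0 <= y <= c], [1 / (1 - y) = 1 + y / (1 - y) <= 1 + y / (1 - c)], which reduces to
    [prod1D_bounded] with constant [c / (1 - c)]. *)
Lemma prod1B_inv_bounded c x : 0 <= c < 1 -> 0 <= x < 1 ->
  exists2 B, 0 < B & forall n, (\prod_(0 <= i < n) (1 - c * x ^+ i))^-1 <= B.
Proof.
move=> /andP[c0 c1] x01; have /andP[x0 x1] := x01.
have c1' : 0 < 1 - c by rewrite subr_gt0.
have [|B hB] := @prod1D_bounded (c / (1 - c)) x _ x01.
  by rewrite divr_ge0 // ltW.
have xn1 n : x ^+ n <= 1 by rewrite exprn_ile1 // ltW.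
have lec i : c * x ^+ i <= c by rewrite ler_piMr.
exists B; first by apply: lt_le_trans (hB 0%N); rewrite big_nil.
move=> n; apply: le_trans (hB n); rewrite -prodfV.
apply: ler_prod => i _; have := lec i; set y := c * x ^+ i => yc.
have y0 : 0 <= y by rewrite mulr_ge0 // exprn_ge0.
have y1 : 0 < 1 - y by lra.
rewrite invr_ge0 ltW //= mulrAC -/y (_ : (1 - y)^-1 = 1 + y / (1 - y)); last first.
  by field; rewrite gt_eqF.
by rewrite lerD2l ler_wpM2l // lef_pV2 ?posrE //; lra.
Qed.

End ProductBounds.

(** * Convergence and nonvanishing of q-Pochhammer symbols *)

Section QPochhammer.
Variable R : realType.
Implicit Types x q : complexes R.

Definition qprod (K : numFieldType) (x q : K) (n : nat) : K :=
  \prod_(0 <= i < n) (1 - x * q ^+ i).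

Lemma qprodS (K : numFieldType) (x q : K) n :
  qprod x q n.+1 = qprod x q n * (1 - x * q ^+ n).
Proof. by rewrite /qprod big_nat_recr. Qed.

Lemma normc_prod (F : nat -> complexes R) n :
  normc (\prod_(0 <= i < n) F i) = \prod_(0 <= i < n) normc (F i).
Proof. by apply: (big_morph (@normc R) (@normcM R)); rewrite normc1. Qed.

(** The partial products are bounded, so their consecutive differences [- qprod x q n * x * q ^+ n]
    form a series dominated by a geometric one. *)
Lemma qprod_cvg x q : normc q < 1 -> cvgn (qprod x q).
Proof.
move=> q1; have q01 : 0 <= normc q < 1 by rewrite normc_ge0.
have [B hB] := prod1D_bounded (normc_ge0 x) q01.
have E : qprod x q = (fun n => 1 + series (fun n => qprod x q n.+1 - qprod x q n) n).
  apply/funext => n; rewrite /series /= telescope_sumr //.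
  have -> : qprod x q 0 = 1 by rewrite /qprod big_geq.
  by rewrite addrC subrK.
rewrite E; apply: is_cvgD; first exact: is_cvg_cst.
apply: (@normc_series_cvg _ _ (geometric (B * normc x) (normc q))).
  move=> n; rewrite qprodS mulrBr mulr1 addrAC subrr add0r normcN !normcM normcX /=.
  rewrite mulrA ler_wpM2r ?exprn_ge0 ?normc_ge0 // ler_wpM2r ?normc_ge0 //.
  apply: le_trans (hB n); rewrite normc_prod; apply: ler_prod => i _.
  rewrite normc_ge0 /=; apply: le_trans (le_normcD _ _) _.
  by rewrite normc1 normcN normcM normcX.
by apply: is_cvg_geometric_series; rewrite ger0_norm ?normc_ge0.
Qed.

(** The reverse triangle inequality bounds each factor below by [1 - normc x * normc q ^+ i]. *)
Lemma qprod_inv_bounded x q : normc x < 1 -> normc q < 1 ->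
  exists2 B, 0 < B & forall n, normc (qprod x q n)^-1 <= B.
Proof.
move=> x1 q1.
have [||B B0 hB] := @prod1B_inv_bounded R (normc x) (normc q).
- by rewrite normc_ge0.
- by rewrite normc_ge0.
exists B => // n; apply: le_trans (hB n); rewrite normcV normc_prod -!prodfV.
apply: ler_prod => i _; rewrite invr_ge0 normc_ge0 /=.
have y1 : normc x * normc q ^+ i < 1.
  apply: le_lt_trans x1; rewrite ler_piMr ?normc_ge0 //.
  by rewrite exprn_ile1 ?normc_ge0 // ltW.
have le : 1 - normc x * normc q ^+ i <= normc (1 - x * q ^+ i).
  rewrite lerBlDr -normcX -normcM -(normc1 R) -[X in normc X <= _](subrK (x * q ^+ i)).
  exact: le_normcD.
have y0 : 0 < 1 - normc x * normc q ^+ i by rewrite subr_gt0.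
by rewrite lef_pV2 ?posrE //; apply: lt_le_trans le.
Qed.

Lemma qprod_neq0 x q n : normc x < 1 -> normc q < 1 -> qprod x q n != 0.
Proof.
move=> x1 q1; elim: n => [|i IH]; first by rewrite /qprod big_geq ?oner_eq0.
rewrite qprodS mulf_neq0 // subr_eq0; apply/eqP => E.
have : normc (x * q ^+ i) < 1.
  rewrite normcM normcX; apply: le_lt_trans x1; rewrite ler_piMr ?normc_ge0 //.
  by rewrite exprn_ile1 ?normc_ge0 // ltW.
by rewrite -E normc1 ltxx.
Qed.

(** A zero limit would contradict the bound on the inverses of the partial products. *)
Lemma qpoch_inf_neq0 x q : normc x < 1 -> normc q < 1 -> qpoch_inf x q != 0.
Proof.
move=> x1 q1; have [B B0 hB] := qprod_inv_bounded x1 q1.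
apply/eqP => l0; have : qprod x q @ \oo --> (0 : complexes R).
  by rewrite -l0; exact: qprod_cvg.
move=> /cvg_normcP/cvgrPdist_lt/(_ B^-1); rewrite invr_gt0.
move=> /(_ B0)[n _ /(_ n (leqnn n))] /=.
rewrite subr0 sub0r normrN ger0_norm ?normc_ge0 // ltNge => /negP; apply.
have n0 : 0 < normc (qprod x q n).
  rewrite lt_def normc_ge0 andbT; apply/eqP => /eq0_normc/eqP.
  exact/negP/qprod_neq0.
by rewrite -lef_pV2 ?posrE ?invr_gt0 // invrK -normcV.
Qed.

(** The first [n] factors of the infinite product split off, and the rest converges to the nonzero
    denominator of [qpoch]. *)
Lemma qpochE x q n : normc x < 1 -> normc q < 1 -> qpoch x q n = qprod x q n.
Proof.
move=> x1 q1; rewrite /qpoch; apply/eqP; rewrite eq_sym.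
have xq1 : normc (x * q ^+ n) < 1.
  rewrite normcM normcX; apply: le_lt_trans x1; rewrite ler_piMr ?normc_ge0 //.
  by rewrite exprn_ile1 ?normc_ge0 // ltW.
rewrite -(can_eq (mulfK (qpoch_inf_neq0 xq1 q1))) divfK ?qpoch_inf_neq0 //.
apply/eqP/esym/cvg_lim => //.
rewrite -(cvg_shiftn n) /=.
rewrite (_ : (fun _ => _) = fun m => qprod x q n * qprod (x * q ^+ n) q m).
  by apply: cvgMr; exact: qprod_cvg.
apply/funext => m; rewrite /qprod (@big_cat_nat _ _ _ n) ?leq_addl //=; congr (_ * _).
rewrite -{1}[n]add0n big_addn addnK; apply: eq_bigr => i _.
by rewrite exprD mulrAC mulrA.
Qed.

End QPochhammer.

(** * Limits and bounds of the truncated factors *)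

(** With [z = y ^+ t], the closed form of [2 * (z ^+ r + z ^+ r.+1 + ...)] on [s], and of
    [1 + 2 * (z + z ^+ 2 + ...)] elsewhere. *)
Definition limit_factor (K : fieldType) (r : nat) (s : seq nat) (y : K) t : K :=
  (if t \in s then 2 * y ^+ (t * r) else 1 + y ^+ t) / (1 - y ^+ t).

(** The correction is the missing geometric tail over multiplicities above [M]; it is the same for
    [t] in or outside [s] because [r <= M]. *)
Lemma trunc_factorE (K : fieldType) r M s (y : K) t :
  (0 < r <= M)%N -> 1 - y ^+ t != 0 ->
  trunc_factor r M s y t =
  limit_factor r s y t - 2 * y ^+ (t * M.+1) / (1 - y ^+ t).
Proof.
move=> /andP[r0 rM] yt; rewrite /trunc_factor /limit_factor.
rewrite (sum_multiplicities M (fun m => ((t \in s) ==> (r <= m)%N)%:R * y ^+ (t * m))).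
rewrite muln0 expr0 mulr1 leqNgt r0 /= -mulrBl; apply: (canRL (mulfK yt)).
case: (t \in s) => /=; rewrite !exprM; set z := y ^+ t.
  have [r' rE] : exists r', r = r'.+1 by exists r.-1; rewrite prednK.
  rewrite rE in rM *; elim: M rM => // M IH; rewrite leq_eqVlt => /orP[/eqP <-|rM].
    rewrite big_nat_recr //= leqnn /= exprM -/z big_nat.
    rewrite big1 => [|m /andP[_ mr]]; last first.
      by rewrite leqNgt mr mul0r.
    by rewrite !exprS; ring.
  rewrite big_nat_recr //= (ltnW rM) /= [2 * (_ + _)]mulrDr addrA mulrDl IH // exprM -/z.
  by rewrite !exprS; ring.
elim: {rM}M => [|M IH]; first by rewrite big_nil; ring.
rewrite big_nat_recr //= [2 * (_ + _)]mulrDr addrA mulrDl IH // exprM -/z.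
by rewrite !exprS; ring.
Qed.

(** The exponent comes from summing [a + j * A] over [j < k], which gives [A * 'C(k, 2) + k * a]. *)
Lemma prod_progression (K : numFieldType) r A a k (y : K) :
  \prod_(0 <= j < k) (2 * y ^+ ((a + j * A) * r) / (1 + y ^+ (a + j * A))) =
  2 ^+ k * y ^+ (r * (A * 'C(k, 2) + k * a)) / qprod (- y ^+ a) (y ^+ A) k.
Proof.
elim: k => [|k IH]; first by rewrite /qprod !big_geq // expr0 muln0 muln0 invr1 !mulr1.
rewrite big_nat_recr //= IH qprodS invfM mulNr opprK -exprM -exprD [(A * k)%N]mulnC.
rewrite exprSr binS bin1.
have -> : (r * (A * ('C(k, 2) + k) + k.+1 * a) =
          r * (A * 'C(k, 2) + k * a) + (a + k * A) * r)%N by rewrite mulSn; ring.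
rewrite [y ^+ (r * _ + _)]exprD; set u := (_ + _)^-1; set v := y ^+ (_ * r).
set w := y ^+ (r * _); set p := (qprod _ _ _)^-1; set h := 2 ^+ k; ring.
Qed.

Lemma uniq_progression A a k : (0 < A)%N -> uniq (progression A a k).
Proof.
move=> A0; rewrite map_inj_uniq ?iota_uniq // => i j /addnI/eqP.
by rewrite eqn_pmul2r // => /eqP.
Qed.

(** Requiring density at [t] multiplies the ordinary factor by [2 * y ^+ (t * r) / (1 + y ^+ t)];
    these quotients are collected along the progression. *)
Lemma prod_limit_factor (K : numFieldType) r A a k N (y : K) :
    (0 < A)%N -> (forall t, (0 < t)%N -> 1 + y ^+ t != 0) ->
    {subset progression A a k <= index_iota 1 N.+1} ->
  \prod_(1 <= t < N.+1) limit_factor r (progression A a k) y t =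
  \prod_(1 <= t < N.+1) ((1 + y ^+ t) / (1 - y ^+ t)) *
  (2 ^+ k * y ^+ (r * (A * 'C(k, 2) + k * a)) / qprod (- y ^+ a) (y ^+ A) k).
Proof.
move=> A0 yt sub; rewrite -prod_progression.
rewrite -[in RHS](big_map (fun j => a + j * A)%N predT
  (fun t => 2 * y ^+ (t * r) / (1 + y ^+ t))) /index_iota subn0 -/(progression A a k).
rewrite [X in _ = _ * X](@perm_big _ _ _ _ _
  [seq t <- index_iota 1 N.+1 | t \in progression A a k]); last first.
  apply: uniq_perm; rewrite ?filter_uniq ?iota_uniq ?uniq_progression // => t.
  by rewrite mem_filter andb_idr //; exact: sub.
rewrite big_filter [X in _ = _ * X]big_mkcond -big_split /=.
apply: eq_big_nat => t /andP[t0 _]; rewrite /limit_factor; case: ifP => _; last by rewrite mulr1.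
rewrite -[LHS]mulr1 -[X in _ * X = _](divff (yt _ t0)); set p := (1 + y ^+ t)^-1.
set d := (1 - y ^+ t)^-1; set v := y ^+ (_ * _); ring.
Qed.

Lemma prod_ratio (K : numFieldType) N (y : K) :
  \prod_(1 <= t < N.+1) ((1 + y ^+ t) / (1 - y ^+ t)) = qprod (- y) y N / qprod y y N.
Proof.
rewrite big_add1 /= /qprod -prodf_div; apply: eq_bigr => i _.
by rewrite mulNr opprK -exprS.
Qed.

(** * A uniform bound for real arguments *)

Section RealBounds.
Variable R : realType.
Variables (r A a : nat) (x : R).
Hypotheses (aA : (1 <= a <= A)%N) (r0 : (1 <= r)%N) (x01 : 0 <= x < 1).

Let x0 : 0 <= x. Proof. by case/andP: x01. Qed.
Let x1 : x < 1. Proof. by case/andP: x01. Qed.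

(** This series is the common majorant for all sums over [k]. Its terms are at most
    [4 ^+ m * 2^-1 ^+ k], where [x ^+ k <= 4^-1] from [m] on. *)
Lemma cvg_series_gauss : cvgn (series (fun k => 2 ^+ k * x ^+ 'C(k, 2))).
Proof.
have [m hm] : exists m, forall k, (m <= k)%N -> x ^+ k <= 4^-1.
  have /cvgrPdist_lt/(_ 4^-1) : (fun k => x ^+ k) @ \oo --> (0 : R).
    by apply: cvg_expr; rewrite ger0_norm.
  case=> [|m _ hm]; first by rewrite invr_gt0.
  exists m => k /hm /=; rewrite sub0r normrN ger0_norm ?exprn_ge0 // => /ltW.
  by [].
(* Passing from [k] to [k.+1] multiplies the left side by [4 * x ^+ k], which is at most [4], and at
   most [1] once [m <= k]. *)
have le k : 2 ^+ k * (2 ^+ k * x ^+ 'C(k, 2)) <= 4 ^+ minn k m.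
  elim: k => [|k IH]; first by rewrite min0n !expr0 !mulr1.
  have -> : 2 ^+ k.+1 * (2 ^+ k.+1 * x ^+ 'C(k.+1, 2)) =
      2 ^+ k * (2 ^+ k * x ^+ 'C(k, 2)) * (4 * x ^+ k).
    by rewrite binS bin1 exprD !exprS; ring.
  have [km|mk] := ltnP k m.
    rewrite (minn_idPl km) exprSr; rewrite (minn_idPl (ltnW km)) in IH.
    rewrite ler_pM ?mulr_ge0 ?exprn_ge0 //.
    by rewrite ler_piMr // exprn_ile1 // ltW.
  rewrite (minn_idPr (leqW mk)); rewrite (minn_idPr mk) in IH.
  apply: le_trans IH; rewrite ler_piMr ?mulr_ge0 ?exprn_ge0 //.
  by rewrite -ler_pdivlMl // mulr1 hm.
apply: (@series_le_cvg _ _ (geometric (4 ^+ m) 2^-1)) => [k|k|k|].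
- by rewrite mulr_ge0 ?exprn_ge0.
- by rewrite /= mulr_ge0 ?exprn_ge0.
- rewrite /= exprVn ler_pdivlMr ?exprn_gt0 // mulrC; apply: le_trans (le k) _.
  by rewrite ler_weXn2l ?geq_minr // ler1n.
- by apply: is_cvg_geometric_series; rewrite ger0_norm ?invr_ge0 // invf_lt1 // ltr1n.
Qed.

Let xt1 t : (0 < t)%N -> 0 < 1 - x ^+ t.
Proof. by move=> t0; rewrite subr_gt0 exprn_ilt1 // -lt0n. Qed.

Lemma prod_trunc_factor_le s M N : (r <= M)%N ->
  \prod_(1 <= t < N.+1) trunc_factor r M s x t <=
  \prod_(1 <= t < N.+1) limit_factor r s x t.
Proof.
move=> rM; rewrite big_nat [leRHS]big_nat; apply: ler_prod => t /andP[t0 _].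
apply/andP; split.
  by apply: sumr_ge0 => c _; rewrite mulr_ge0 ?exprn_ge0.
rewrite trunc_factorE ?r0 ?gt_eqF ?xt1 // gerBl.
by rewrite divr_ge0 ?mulr_ge0 ?exprn_ge0 // ltW ?xt1.
Qed.

(** Each truncated product is at most its limit, which is at most [B1 * B2] times a term of the
    majorant; the bound depends on neither [M] nor [L]. *)
Lemma trunc_mes_gf_bounded : exists B, forall M L, (r <= M)%N ->
  trunc_mes_gf r A a M (a + L * A) x <= B.
Proof.
have [A0 a0] : (0 < A)%N /\ (0 < a)%N by lia.
have [B1 hB1] := prod1D_bounded x0 x01.
have [B2 B2_0 hB2] := prod1B_inv_bounded x01 x01.
have B1_0 : 0 <= B1 by apply: le_trans (hB1 0%N); rewrite big_nil.
pose V := limn (series (fun k => 2 ^+ k * x ^+ 'C(k, 2))).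
have ratio N : \prod_(1 <= t < N.+1) ((1 + x ^+ t) / (1 - x ^+ t)) <= B1 * B2.
  rewrite prod_ratio ler_pM //.
  - by apply: prodr_ge0 => i _; rewrite mulNr opprK addr_ge0 // mulr_ge0 ?exprn_ge0.
  - rewrite invr_ge0; apply: prodr_ge0 => i _.
    by rewrite -exprS ltW // xt1.
  - by rewrite /qprod; under eq_bigr do rewrite mulNr opprK; exact: hB1.
  - exact: hB2.
have bound k N : {subset progression A a k <= index_iota 1 N.+1} ->
    \prod_(1 <= t < N.+1) limit_factor r (progression A a k) x t <=
    B1 * B2 * (2 ^+ k * x ^+ 'C(k, 2)).
  move=> sub; rewrite prod_limit_factor // => [|t _]; last first.
    by rewrite gt_eqF // ltr_pwDl // exprn_ge0.
  have qp : 1 <= qprod (- x ^+ a) (x ^+ A) k.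
    rewrite /qprod; elim: k {sub} => [|k IH]; first by rewrite big_geq.
    rewrite big_nat_recr //=; apply: (le_trans IH).
    rewrite ler_peMr ?(le_trans ler01) // mulNr opprK lerDl.
    by rewrite mulr_ge0 ?exprn_ge0.
  rewrite ler_pM ?ratio //.
  - rewrite prod_ratio mulr_ge0 ?invr_ge0 //.
      by apply: prodr_ge0 => i _; rewrite mulNr opprK addr_ge0 // mulr_ge0 ?exprn_ge0.
    by apply: prodr_ge0 => i _; rewrite -exprS ltW // xt1.
  - by rewrite divr_ge0 ?mulr_ge0 ?exprn_ge0 // (le_trans ler01).
  - rewrite ler_pdivrMr ?(lt_le_trans ltr01) //.
    apply: (@le_trans _ _ (2 ^+ k * x ^+ 'C(k, 2))); last first.
      by rewrite ler_peMr // mulr_ge0 ?exprn_ge0.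
    rewrite ler_wpM2l ?exprn_ge0 // ler_wiXn2l // ?ltW //.
    (* The exponent [r * (A * 'C(k, 2) + k * a)] is at least ['C(k, 2)]. *)
    apply: leq_trans (leq_pmull _ r0); apply: leq_trans (leq_addr _ _).
    exact: leq_pmull.
exists (a%:R * (B1 * B2) + A%:R * (B1 * B2 * V)) => M L rM.
rewrite trunc_mes_gfE // lerD ?ler_wpM2l //.
  apply: le_trans (prod_trunc_factor_le _ _ rM) _.
  (* The unconstrained product is the case [k = 0], with an empty progression. *)
  by have := bound 0%N (a + L * A)%N; rewrite /progression /= expr0 expr0 !mulr1; apply.
apply: (@le_trans _ _ (\sum_(1 <= k < L.+2) B1 * B2 * (2 ^+ k * x ^+ 'C(k, 2)))).
  apply: ler_sum_nat => k /andP[_ kL].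
  apply: le_trans (prod_trunc_factor_le _ _ rM) _; apply: bound.
  apply: progression_sub => // j jk.
  by rewrite leq_add2l leq_mul2r; apply/orP; right; lia.
rewrite -mulr_sumr ler_wpM2l ?mulr_ge0 // ?(ltW B2_0) //.
apply: (@le_trans _ _ (series (fun k => 2 ^+ k * x ^+ 'C(k, 2)) L.+2)).
  by rewrite /series /= [leRHS]big_ltn // lerDr mulr_ge0 ?exprn_ge0.
apply: nondecreasing_cvgn_le; last exact: cvg_series_gauss.
by apply: nondecreasing_series => k _; rewrite mulr_ge0 ?exprn_ge0.
Qed.

End RealBounds.

(** * Convergence of the series *)

Lemma cvgn_prod (K : numFieldType) (I : eqType) (s : seq I)
    (F : I -> nat -> K) (G : I -> K) :
  (forall i, i \in s -> F i @ \oo --> G i) ->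
  (fun n => \prod_(i <- s) F i n) @ \oo --> \prod_(i <- s) G i.
Proof.
elim: s => [|i s IH] FG.
  by under eq_cvg do rewrite big_nil; rewrite big_nil; exact: cvg_cst.
under eq_cvg do rewrite big_cons; rewrite big_cons; apply: cvgM.
  by apply: FG; rewrite mem_head.
by apply: IH => j js; apply: FG; rewrite inE js orbT.
Qed.

Lemma cvgn_sum (K : numFieldType) (I : eqType) (s : seq I)
    (F : I -> nat -> K) (G : I -> K) :
  (forall i, i \in s -> F i @ \oo --> G i) ->
  (fun n => \sum_(i <- s) F i n) @ \oo --> \sum_(i <- s) G i.
Proof.
elim: s => [|i s IH] FG.
  by under eq_cvg do rewrite big_nil; rewrite big_nil; exact: cvg_cst.
under eq_cvg do rewrite big_cons; rewrite big_cons; apply: cvgD.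
  by apply: FG; rewrite mem_head.
by apply: IH => j js; apply: FG; rewrite inE js orbT.
Qed.

Section MesSeries.
Variables (R : realType) (r A a : nat) (q : complexes R).
Hypotheses (aA : (1 <= a <= A)%N) (r0 : (1 <= r)%N) (q1 : normc q < 1).

Let q01 : 0 <= normc q < 1. Proof. by rewrite normc_ge0. Qed.
Let A0 : (0 < A)%N. Proof. by lia. Qed.
Let a0 : (0 < a)%N. Proof. by lia. Qed.

Let normc_qX t : (0 < t)%N -> normc (q ^+ t) < 1.
Proof. by move=> t0; rewrite normcX exprn_ilt1 ?normc_ge0 // -lt0n. Qed.

Let qB t : (0 < t)%N -> 1 - q ^+ t != 0.
Proof.
move=> /normc_qX; rewrite subr_eq0; case: eqP => // <-.
by rewrite normc1 ltxx.
Qed.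

Let qD t : (0 < t)%N -> 1 + q ^+ t != 0.
Proof.
move=> /normc_qX; rewrite addrC addr_eq0; case: eqP => // ->.
by rewrite normcN normc1 ltxx.
Qed.

(** Generic in [K], so that it can be evaluated both at [q] and at the real number [normc q]. *)
Let lhs (K : comNzRingType) (y : K) N :=
  \sum_(0 <= n < N) (sigma_mes r A a n)%:R * y ^+ n.

(** Below weight [L] the truncation loses no overpartition, so those coefficients cancel. *)
Lemma trunc_mes_gf_tail (K : comNzRingType) M N L (y : K) : (L <= M)%N -> (L <= N)%N ->
  exists2 B, (L <= B)%N & trunc_mes_gf r A a M N y - lhs y L =
    \sum_(L <= n < B) (\sum_(pi <- bounded_overpartitions M N
      | sumn (part_sizes pi) == n) mes r A a pi)%N%:R * y ^+ n.
Proof.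
move=> LM LN; have [B0 hB] := trunc_mes_gf_sum r A a M N y.
exists (maxn L B0); first exact: leq_maxl.
rewrite (hB _ (leq_maxr L B0)) (big_cat_nat (leq0n L) (leq_maxl L B0)) /=.
rewrite [X in X + _ - _](_ : _ = lhs y L); first by rewrite addrAC subrr add0r.
apply: eq_big_nat => n /andP[_ nL]; congr (_%:R * _).
by rewrite [RHS](@sigma_mesE _ _ _ _ M N) // ltnW // (leq_trans nL).
Qed.

Lemma lhs_norm_cvg : cvgn (lhs (normc q)).
Proof.
have [B hB] := trunc_mes_gf_bounded aA r0 q01.
have nd : nondecreasing_seq (lhs (normc q)).
  apply: nondecreasing_series => n _.
  by rewrite mulr_ge0 ?exprn_ge0 ?normc_ge0.
apply: nondecreasing_is_cvgn => //; exists B => _ [L _ <-].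
(* The bound needs [r <= M] and the comparison needs [L <= M]; [maxn L r] serves both. *)
apply: le_trans (hB (maxn L r) L (leq_maxr _ _)).
have LN : (L <= a + L * A)%N.
  by apply: leq_trans (leq_addl _ _); rewrite leq_pmulr.
have [C _ E] := trunc_mes_gf_tail (normc q) (leq_maxl L r) LN.
rewrite -subr_ge0 E; apply: sumr_ge0 => n _.
by rewrite mulr_ge0 ?exprn_ge0 ?normc_ge0.
Qed.

Let defect L := limn (lhs (normc q)) - lhs (normc q) L.

(** Truncated coefficients are at most the full ones, so the difference is dominated by a tail of
    the convergent series at [normc q]. *)
Lemma trunc_mes_gf_defect M N L : (L <= M)%N -> (L <= N)%N ->
  normc (trunc_mes_gf r A a M N q - lhs q L) <= defect L.
Proof.
move=> LM LN; have [B LB ->] := trunc_mes_gf_tail q LM LN.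
apply: (@le_trans _ _ (lhs (normc q) B - lhs (normc q) L)); last first.
  rewrite lerD2r; apply: nondecreasing_cvgn_le; last exact: lhs_norm_cvg.
  apply: nondecreasing_series => n _.
  by rewrite mulr_ge0 ?exprn_ge0 ?normc_ge0.
rewrite /lhs (big_cat_nat (leq0n L) LB) /= addrAC subrr add0r.
elim/big_rec2: _ => [|n z w _ le]; first by rewrite normc0.
apply: le_trans (le_normcD _ _) _; rewrite lerD // normcM normcX.
rewrite ler_wpM2r ?exprn_ge0 ?normc_ge0 //.
have -> m : normc (m%:R : complexes R) = m%:R.
  by rewrite normcMn normc1.
by rewrite ler_nat leq_sigma_mes.
Qed.

Lemma cvg_trunc_factor s t : (0 < t)%N ->
  (fun M => trunc_factor r M s q t) @ \oo --> limit_factor r s q t.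
Proof.
move=> t0.
have h : (fun M => limit_factor r s q t - 2 * (q ^+ t) ^+ M.+1 / (1 - q ^+ t)) @ \oo -->
    limit_factor r s q t.
  rewrite -[X in _ --> X](subr0 (limit_factor r s q t)).
  apply: cvgB; first exact: cvg_cst.
  rewrite -[X in _ --> X](mul0r (1 - q ^+ t)^-1) -[X in X * _](mulr0 2).
  apply: cvgMl; apply: cvgMr.
  by rewrite (cvg_shiftS (fun M => (q ^+ t) ^+ M)); apply: cvg_exprC; exact: normc_qX.
(* The exact formula for the truncated factor holds only once [r <= M]. *)
apply: cvg_trans h; apply: near_eq_cvg; exists r => // M /= rM.
by rewrite trunc_factorE ?qB ?r0 //= exprM.
Qed.

Let rhs := fun N : nat => \sum_(1 <= k < N)
  (2 ^+ k * q ^+ (r * (A * 'C(k, 2) + k * a))) / qpoch (- q ^+ a) (q ^+ A) k.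

Let nqa : normc (- q ^+ a) < 1. Proof. by rewrite normcN normc_qX. Qed.

(** The index [L.+2] allows [k] up to [L.+1], the number of progression terms not exceeding
    [a + L * A]. *)
Let closed L : complexes R :=
  qprod (- q) q (a + L * A) / qprod q q (a + L * A) * (a%:R + A%:R * rhs L.+2).

Lemma cvg_trunc_mes_gf L :
  (fun M => trunc_mes_gf r A a M (a + L * A) q) @ \oo --> closed L.
Proof.
pose N := (a + L * A)%N.
have tf s : (fun M => \prod_(1 <= t < N.+1) trunc_factor r M s q t) @ \oo -->
    \prod_(1 <= t < N.+1) limit_factor r s q t.
  apply: (@cvgn_prod _ _ _ (fun t M => trunc_factor r M s q t)) => t.
  by rewrite mem_index_iota => /andP[t0 _]; exact: cvg_trunc_factor.
rewrite /closed -prod_ratio mulrDr.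
under eq_cvg do rewrite trunc_mes_gfE //.
apply: cvgD.
  rewrite mulrC; apply: cvgMr.
  rewrite (_ : \prod_(1 <= t < N.+1) _ = \prod_(1 <= t < N.+1) limit_factor r [::] q t).
    exact: tf.
  by apply: eq_bigr => t _.
rewrite mulrCA; apply: cvgMr; rewrite mulr_sumr.
rewrite [X in _ --> X](_ : _ =
  \sum_(1 <= k < L.+2) \prod_(1 <= t < N.+1) limit_factor r (progression A a k) q t).
  apply: (@cvgn_sum _ _ _ (fun k M => \prod_(1 <= t < N.+1)
     trunc_factor r M (progression A a k) q t)) => k _.
  exact: tf.
apply: eq_big_nat => k /andP[_ kL].
rewrite prod_limit_factor // ?qpochE ?normc_qX //.
apply: progression_sub => // j jk.
by rewrite leq_add2l leq_mul2r; apply/orP; right; lia.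
Qed.

(** The bound of [trunc_mes_gf_defect] does not depend on [M], so it survives the limit in [M]. *)
Lemma closed_defect L : normc (lhs q L - closed L) <= defect L.
Proof.
apply/ler_addgt0Pr => e e0.
have LN : (L <= a + L * A)%N.
  by apply: leq_trans (leq_addl _ _); rewrite leq_pmulr.
have /cvg_normcP/cvgrPdist_lt/(_ _ e0)[M0 _ hM] := @cvg_trunc_mes_gf L.
have := hM (maxn L M0) (leq_maxr L M0); set T := trunc_mes_gf _ _ _ _ _ _ => /= lt.
have le : normc (T - lhs q L) <= defect L.
  by apply: trunc_mes_gf_defect; rewrite ?leq_maxl.
rewrite -normcN opprB -(subrK T (closed L)) -addrA addrC.
apply: le_trans (le_normcD _ _) _; apply: lerD => //.
move: lt; rewrite sub0r normrN ger0_norm ?normc_ge0 // => /ltW.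
by rewrite -normcN opprB.
Qed.

Lemma rhs_cvg : cvgn rhs.
Proof.
have [B B0 hB] := qprod_inv_bounded nqa (normc_qX A0).
pose f k := (2 ^+ k * q ^+ (r * (A * 'C(k, 2) + k * a))) / qpoch (- q ^+ a) (q ^+ A) k.
(* [series] starts at index [0] whereas the sum starts at [1], hence the zero term. *)
pose f' k := if k == 0%N then 0 else f k.
have -> : rhs = series f'.
  apply/funext => -[|N]; first by rewrite /rhs /series /= !big_geq.
  rewrite /rhs /series /= [RHS]big_ltn //= add0r; apply: eq_big_nat => k /andP[k0 _].
  by rewrite /f' gtn_eqF.
apply: (@normc_series_cvg _ _ (fun k => B * (2 ^+ k * normc q ^+ 'C(k, 2)))).
  move=> k; rewrite /f'; case: eqP => _.
    by rewrite normc0 !mulr_ge0 ?exprn_ge0 ?normc_ge0 // ltW.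
  rewrite /f qpochE ?normc_qX // normcM mulrC ler_pM ?normc_ge0 // normcM !normcX.
  have -> : normc (2 : complexes R) = 2 by rewrite normcMn normc1.
  rewrite ler_wpM2l ?exprn_ge0 // ler_wiXn2l ?normc_ge0 // ?ltW //.
  apply: leq_trans (leq_pmull _ r0); apply: leq_trans (leq_addr _ _).
  exact: leq_pmull.
by apply: is_cvg_seriesZ; exact: cvg_series_gauss.
Qed.

Lemma closed_cvg : closed @ \oo -->
  qpoch_inf (- q) q / qpoch_inf q q * (a%:R + A%:R * limn rhs).
Proof.
have N_oo : (fun L => a + L * A)%N @ \oo --> \oo.
  move=> P [m _ mP]; exists m => // L /= mL; apply: mP => /=.
  by apply: leq_trans mL (leq_trans _ (leq_addl _ _)); rewrite leq_pmulr.
apply: cvgM.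
  apply: cvgM.
    apply: (cvg_comp _ _ N_oo); exact: qprod_cvg.
  apply: cvgV; first exact: qpoch_inf_neq0.
  apply: (cvg_comp _ _ N_oo); exact: qprod_cvg.
apply: cvgD; first exact: cvg_cst.
apply: cvgMr; rewrite (cvg_shiftS (fun L => rhs L.+1)) (cvg_shiftS rhs).
exact: rhs_cvg.
Qed.

(** The defect tends to [0], so [lhs q] and [closed] have the same limit. *)
Lemma lhs_cvg : lhs q @ \oo -->
  qpoch_inf (- q) q / qpoch_inf q q * (a%:R + A%:R * limn rhs).
Proof.
have d0 : (fun L => lhs q L - closed L) @ \oo --> (0 : complexes R).
  apply: (@normc_le_cvg _ _ _ defect) => [L|]; first by rewrite subr0 closed_defect.
  rewrite -[X in _ --> X](subrr (limn (lhs (normc q)))).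
  by apply: cvgB; [exact: cvg_cst|exact: lhs_norm_cvg].
rewrite -[X in _ --> X]add0r.
rewrite (_ : lhs q = fun L => lhs q L - closed L + closed L); last first.
  by apply/funext => L; rewrite subrK.
exact: cvgD d0 closed_cvg.
Qed.

End MesSeries.

Theorem theorem2p2 (R : realType) (A a r : nat) (q : complexes R)
    (haA : (1 <= a <= A)%N) (hr : (1 <= r)%N) (hq : `|q| < 1) :
  let lhs := fun N : nat =>
    \sum_(0 <= n < N) (sigma_mes r A a n)%:R * q ^+ n in
  let rhs := fun N : nat =>
    \sum_(1 <= k < N)
      (2 ^+ k * q ^+ (r * (A * 'C(k, 2) + k * a))) / qpoch (- q ^+ a) (q ^+ A) k in
  [/\ cvgn lhs, cvgn rhs
    & limn lhs = qpoch_inf (- q) q / qpoch_inf q q * (a%:R + A%:R * limn rhs)].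
Proof.
have q1 : normc q < 1 by rewrite -ltcR.
move=> lhs rhs; have lhsE := lhs_cvg haA hr q1; split.
- exact: cvgP lhsE.
- exact: rhs_cvg.
- exact: cvg_lim lhsE.
Qed.
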